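(* Let $n\ge 1$, let $E_{\mathrm{out}}=\mathbb{S}^{n-1}\subset\mathbb{R}^n$ be the unit sphere, let $A$ be a real symmetric positive definite $n\times n$ matrix, and let $E_{\mathrm{in}}=A\,E_{\mathrm{out}}$, an ellipsoid centered at the origin. Assume that $E_{\mathrm{in}}$ and $E_{\mathrm{out}}$ are disjoint and $E_{\mathrm{in}}\subset\operatorname{conv}(E_{\mathrm{out}})$. Let $\mathcal{P}_t(E_{\mathrm{in}},E_{\mathrm{out}})$ be the set of all labeled parallelotopes fitting tightly between $E_{\mathrm{out}}$ and $E_{\mathrm{in}}$. Then $\mathcal{P}_t(E_{\mathrm{in}},E_{\mathrm{out}})$ is nonempty if and only if $\operatorname{tr}(A^2)=1$. In this case, the map $\phi:\mathcal{P}_t(E_{\mathrm{in}},E_{\mathrm{out}})\to O(n)$, taking a parallelotope with label $(v_k)_{1\le k\le n}$ to the matrix $Q\in O(n)$ whose columns are obtained from the basis $(v_k)$ by Gram-Schmidt orthonormalization, is a diffeomorphism.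
   Context: $\operatorname{conv}$ denotes convex hull and $O(n)$ the real orthogonal group. A centrally symmetric parallelotope in $\mathbb{R}^n$ is a convex polytope with $2^n$ vertices of the form $\pm v_1\pm v_2\pm\cdots\pm v_n$, where $v_1,\ldots,v_n$ is a basis of $\mathbb{R}^n$. A label for it is such a family $(v_k)_{1\le k\le n}$. A labeled parallelotope is a centrally symmetric parallelotope together with a label (so it is determined by its label, and the set of labeled parallelotopes is regarded as a subset of $(\mathbb{R}^n)^n$). A closed convex polytope $P\subset\mathbb{R}^n$ fits between $E_{\mathrm{out}}$ and $E_{\mathrm{in}}$ if $E_{\mathrm{in}}\subset P\subset\operatorname{conv}(E_{\mathrm{out}})$. It is inscribed in $E_{\mathrm{out}}$ if all its vertices belong to $E_{\mathrm{out}}$, and circumscribed to $E_{\mathrm{in}}$ if all its hyperfaces (facets) are tangent to $E_{\mathrm{in}}$. It fits tightly if it fits, is inscribed in $E_{\mathrm{out}}$ and is circumscribed to $E_{\mathrm{in}}$. ''Diffeomorphism'' means a bijection which is smooth with smooth inverse, where $\mathcal{P}_t(E_{\mathrm{in}},E_{\mathrm{out}})$ is viewed inside $(\mathbb{R}^n)^n$ via labels. *)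

(* Defs.v *)
From HB Require Import structures.
From mathcomp Require Import all_boot all_order all_algebra.
From mathcomp Require Import all_classical all_reals all_analysis.

Set Implicit Arguments.
Unset Strict Implicit.
Unset Printing Implicit Defensive.

Import Order.TTheory GRing.Theory Num.Theory.
Import numFieldNormedType.Exports.

Local Open Scope classical_set_scope.
Local Open Scope ring_scope.

(* Vectors of R^n are columns 'cV[R]_n.  The norm `|x| of MathComp-Analysis on
   matrices is the sup norm; it is only used through the topology and the
   differential calculus it induces.  Lengths and angles are given by [dot]. *)

Section Euclidean.
Context {R : realType} {n : nat}.
Implicit Types (x y a w : 'cV[R]_n) (A V Q : 'M[R]_n).
Implicit Types (S P F : set 'cV[R]_n).

Definition dot x y : R := (x^T *m y) 0 0.

Definition enorm x : R := Num.sqrt (dot x x).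

Definition unit_sphere : set 'cV[R]_n := [set x | enorm x = 1].

Definition ellipsoid A : set 'cV[R]_n := mulmx A @` unit_sphere.

Definition posdefmx A : Prop := forall x, x != 0 -> 0 < dot x (A *m x).

Definition orthogonal_group : set 'M[R]_n := [set Q | Q^T *m Q = 1%:M].

Definition convex_hull S : set 'cV[R]_n := smallest (@convex_set R 'cV[R]_n) S.

Definition affine_set S : Prop :=
  forall x y (t : R), S x -> S y -> S ((1 - t) *: x + t *: y).

Definition affine_hull S : set 'cV[R]_n := smallest affine_set S.

Definition hyperplane a (b : R) : set 'cV[R]_n := [set x | dot a x = b].

(* Faces are cut out by valid inequalities; a = 0 gives the improper faces. *)
Definition is_face P F : Prop :=
  exists a (b : R), (forall x, P x -> dot a x <= b) /\ F = P `&` hyperplane a b.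

Definition is_vertex P x : Prop := is_face P [set x].

Definition is_facet P F : Prop :=
  is_face P F /\ exists a (b : R), a != 0 /\ affine_hull F = hyperplane a b.

(* Velocities at x of the curves drawn on S; when S is a submanifold this is
   its tangent space at x, as a linear subspace. *)
Definition tangent_space S x : set 'cV[R]_n :=
  [set w | exists c : R -> 'cV[R]_n,
     [/\ c 0 = x, \forall t \near (0 : R), S (c t) & is_derive (0 : R) 1 c w]].

Definition tangent_to S F : Prop :=
  exists x,
    [/\ S x, F x & affine_hull F = [set x + w | w in tangent_space S x]].

Definition fits (Ein Eout : set 'cV[R]_n) P : Prop :=
  Ein `<=` P /\ P `<=` convex_hull Eout.

Definition inscribed (Eout : set 'cV[R]_n) P : Prop := is_vertex P `<=` Eout.

Definition circumscribed (Ein : set 'cV[R]_n) P : Prop :=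
  forall F, is_facet P F -> tangent_to Ein F.

Definition fits_tightly (Ein Eout : set 'cV[R]_n) P : Prop :=
  [/\ fits Ein Eout P, inscribed Eout P & circumscribed Ein P].

(* A label (v_k)_k, i.e. a point of (R^n)^n, is encoded as the matrix whose
   columns are the v_k. *)
Definition label_seq V : seq 'cV[R]_n := [seq col k V | k <- enum 'I_n].

Definition is_label V : Prop := basis_of {: 'cV[R]_n} (label_seq V).

Definition sign_sum V (e : {ffun 'I_n -> bool}) : 'cV[R]_n :=
  \sum_k (-1) ^+ (e k) *: col k V.

Definition parallelotope V : set 'cV[R]_n := convex_hull (range (sign_sum V)).

(* A labeled parallelotope is determined by, and identified with, its label. *)
Definition tight_parallelotopes (Ein Eout : set 'cV[R]_n) : set 'M[R]_n :=
  [set V | is_label V /\ fits_tightly Ein Eout (parallelotope V)].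

Definition gram_schmidt_step (qs : seq 'cV[R]_n) (v : 'cV[R]_n) :
    seq 'cV[R]_n :=
  let w := v - \sum_(q <- qs) dot q v *: q in rcons qs ((enorm w)^-1 *: w).

Definition gram_schmidt V : 'M[R]_n :=
  let qs := foldl gram_schmidt_step [::] (label_seq V) in
  \matrix_(i, k) (nth 0 qs k) i 0.

End Euclidean.

Section Smooth.
Context {R : realType} {V W : normedModType R}.

(* f is C^k on the open set U (V and W are finite-dimensional below). *)
Fixpoint Ck_on (k : nat) (U : set V) (f : V -> W) : Prop :=
  if k is k'.+1 then
    (forall x, U x -> differentiable f x) /\
    (forall v, Ck_on k' U (fun x => 'D_v f x))
  else forall x, U x -> {for x, continuous f}.

(* Smoothness on an arbitrary subset X: local extendability to a C^oo map on
   an open subset of the ambient space. *)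
Definition smooth_on (X : set V) (f : V -> W) : Prop :=
  forall x, X x -> exists (U : set V) (g : V -> W),
    [/\ open U, U x, forall k, Ck_on k U g & {in U `&` X, f =1 g}].

End Smooth.

Definition diffeomorphism {R : realType} {V W : normedModType R}
    (X : set V) (Y : set W) (f : V -> W) : Prop :=
  [/\ set_bij X Y f, smooth_on X f &
      exists g : W -> V, {in X, cancel f g} /\ smooth_on Y g].

(* Main.v *)
(** The vertices of the parallelotope of V are the sums of the +-v_k; they all
    have norm 1 iff the v_k are pairwise orthogonal and the |v_k|^2 add up to 1.
    For such a V the facets span the hyperplanes <v_k, x> = +-|v_k|^2, and one
    of these is tangent to A S^(n-1) iff the support function |A v_k| of the
    ellipsoid equals |v_k|^2.  With v_k = d_k q_k, q orthonormal and d_k > 0,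
    this says d_k = |A q_k|.  So the frame q, which is what Gram-Schmidt
    returns, determines the label, and any q is allowed provided
    1 = sum |A q_k|^2 = tr (A^2). *)

Require Import Defs.
From HB Require Import structures.
From mathcomp Require Import all_boot all_order all_algebra.
From mathcomp Require Import all_classical all_reals all_analysis.
From mathcomp Require Import ring lra.

Import Order.TTheory GRing.Theory Num.Theory.
Import numFieldNormedType.Exports.

Local Open Scope classical_set_scope.
Local Open Scope ring_scope.

Set Implicit Arguments.
Unset Strict Implicit.
Unset Printing Implicit Defensive.

(** * Euclidean geometry of columns *)

Section Dot.
Context {R : realType} {n : nat}.
Implicit Types (x y z a c : 'cV[R]_n) (M : 'M[R]_n) (b d t : R).

(** Vertices, facets and tangency are defined without coordinates, by valid inequalities, affine
    hulls and velocities of curves, so they must first be brought down to the columns of [V]. The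
    tool is the description of the parallelotope as the image of the cube [-1,1]^n under [V]:
    vertices and facets are found by asking which cube coordinates can still move. Neither the tight
    labels nor the orthogonal matrices form an open set, so smoothness means local extension. On
    tight labels Gram-Schmidt subtracts nothing and only normalizes columns; this formula, like that
    of the inverse, makes sense on the open set of matrices without zero column, where the only
    non-polynomial ingredient is an inverse square root. *)

Lemma dotE x y : dot x y = \sum_i x i 0 * y i 0.
Proof. by rewrite /dot mxE; apply: eq_bigr => i _; rewrite mxE. Qed.

Lemma dotC x y : dot x y = dot y x.
Proof. by rewrite !dotE; apply: eq_bigr => i _; rewrite mulrC. Qed.

Lemma dotDr x y z : dot x (y + z) = dot x y + dot x z.
Proof. by rewrite /dot mulmxDr mxE. Qed.

Lemma dotZr t x y : dot x (t *: y) = t * dot x y.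
Proof. by rewrite /dot -scalemxAr mxE. Qed.

Lemma dotNr x y : dot x (- y) = - dot x y.
Proof. by rewrite /dot mulmxN mxE. Qed.

Lemma dot0r x : dot x 0 = 0.
Proof. by rewrite /dot mulmx0 mxE. Qed.

Lemma dotDl x y z : dot (x + y) z = dot x z + dot y z.
Proof. by rewrite dotC dotDr !(dotC z). Qed.

Lemma dotZl t x y : dot (t *: x) y = t * dot x y.
Proof. by rewrite dotC dotZr dotC. Qed.

Lemma dotNl x y : dot (- x) y = - dot x y.
Proof. by rewrite dotC dotNr dotC. Qed.

Lemma dot0l x : dot 0 x = 0.
Proof. by rewrite dotC dot0r. Qed.

Definition dot_simp := (dotDl, dotDr, dotZl, dotZr, dotNl, dotNr, dot0l, dot0r).

Lemma dot_sumr (I : Type) (r : seq I) (P : pred I) (F : I -> 'cV[R]_n) x :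
  dot x (\sum_(i <- r | P i) F i) = \sum_(i <- r | P i) dot x (F i).
Proof. by rewrite (big_morph _ (dotDr x) (dot0r x)). Qed.

Lemma dot_mulmx M x y : dot x (M *m y) = dot (M^T *m x) y.
Proof. by rewrite /dot trmx_mul trmxK mulmxA. Qed.

Lemma dot_ge0 x : 0 <= dot x x.
Proof. by rewrite dotE sumr_ge0 // => i _; rewrite -expr2 sqr_ge0. Qed.

Lemma dot_eq0 x : (dot x x == 0) = (x == 0).
Proof.
apply/eqP/eqP => [|->]; last exact: dot0r.
rewrite dotE => /eqP; rewrite psumr_eq0; last first.
  by move=> i _; rewrite -expr2 sqr_ge0.
move=> /allP x0; apply/matrixP => i j; rewrite ord1 mxE; apply/eqP.
by rewrite -sqrf_eq0 expr2; exact: x0 (mem_index_enum i).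
Qed.

Lemma dot_gt0 x : (0 < dot x x) = (x != 0).
Proof. by rewrite lt_def dot_eq0 dot_ge0 andbT. Qed.

Lemma Cauchy_Schwarz x y : dot x y ^+ 2 <= dot x x * dot y y.
Proof.
have [->|y0] := eqVneq y 0; first by rewrite !dot_simp expr2 !mulr0.
have yy : 0 < dot y y by rewrite dot_gt0.
have := dot_ge0 (dot y y *: x - dot x y *: y).
rewrite !dot_simp (dotC y x) => h.
rewrite -subr_ge0 -(pmulr_rge0 _ yy); apply: le_trans h _.
by rewrite le_eqVlt; apply/orP; left; apply/eqP; ring.
Qed.

Lemma enorm_eq1 x : enorm x = 1 <-> dot x x = 1.
Proof.
rewrite /enorm; split=> [h|->]; last exact: sqrtr1.
by rewrite -(sqr_sqrtr (dot_ge0 x)) h expr1n.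
Qed.

Lemma enorm_gt0 x : (0 < enorm x) = (x != 0).
Proof. by rewrite /enorm sqrtr_gt0 dot_gt0. Qed.

Lemma enorm_mulmx_gt0 M x : M \in unitmx -> x != 0 -> 0 < enorm (M *m x).
Proof.
move=> uM x0; rewrite enorm_gt0; apply: contra x0 => /eqP Mx.
by rewrite -(mulKmx uM x) Mx mulmx0.
Qed.

Lemma enormZ t x : enorm (t *: x) = `|t| * enorm x.
Proof.
by rewrite /enorm !dot_simp mulrA -expr2 sqrtrM ?sqr_ge0 // sqrtr_sqr.
Qed.

Lemma sqr_enorm x : enorm x ^+ 2 = dot x x.
Proof. by rewrite sqr_sqrtr ?dot_ge0. Qed.

(** The component of [c] orthogonal to [a] is by hypothesis orthogonal to [c] as well, hence to
    itself. *)
Lemma orthogonal_complement_sub a c : a != 0 ->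
  (forall w, dot a w = 0 -> dot c w = 0) -> exists t, c = t *: a.
Proof.
move=> a0 h; have aa : dot a a != 0 by rewrite dot_eq0.
pose t := dot c a / dot a a; exists t; apply/eqP; rewrite -subr_eq0.
have aw : dot a (c - t *: a) = 0 by rewrite !dot_simp (dotC a c) divfK ?subrr.
rewrite -dot_eq0 [X in X == 0](_ : _ = dot c (c - t *: a) - t * dot a (c - t *: a)).
  by rewrite aw (h _ aw) mulr0 subr0.
by rewrite dotDl dotNl dotZl.
Qed.

Lemma hyperplane_sub_eq a b c d : a != 0 -> c != 0 ->
  hyperplane a b `<=` hyperplane c d -> hyperplane a b = hyperplane c d.
Proof.
move=> a0 c0 sub; have aa : dot a a != 0 by rewrite dot_eq0.
(* [p] is the foot of the perpendicular from the origin to the first hyperplane. *)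
pose p := (b / dot a a) *: a.
have ap : dot a p = b by rewrite /p !dot_simp divfK.
have cp : dot c p = d by exact: sub.
have [w aw|t ct] := @orthogonal_complement_sub a c a0.
  have : dot c (p + w) = d by apply: sub; rewrite /hyperplane /= dotDr ap aw addr0.
  by rewrite dotDr cp => /eqP; rewrite -subr_eq0 addrC addKr => /eqP.
have t0 : t != 0 by apply: contraNneq c0 => t0; rewrite ct t0 scale0r.
rewrite eqEsubset; split=> // x; rewrite /hyperplane /= -cp ct !dotZl ap.
by move=> /(mulfI t0).
Qed.

Lemma affine_hyperplane a b : affine_set (hyperplane a b).
Proof.
by move=> x y t; rewrite /hyperplane /= !dot_simp => -> ->; ring.
Qed.

Lemma affine_hull0 : affine_hull (set0 : set 'cV[R]_n) = set0.
Proof.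
by rewrite -subset0; apply: smallest_sub => // x y t.
Qed.

End Dot.

(** * Labels as invertible matrices; convexity with explicit weights *)

Section Labels.
Context {R : realType} {n : nat}.
Implicit Types (k : 'I_n) (x s : 'cV[R]_n) (V : 'M[R]_n) (C : set 'cV[R]_n).

Lemma mulmx_sum_col V s : V *m s = \sum_k s k 0 *: col k V.
Proof.
apply/matrixP => i j; rewrite ord1 mxE summxE; apply: eq_bigr => k _.
by rewrite !mxE mulrC.
Qed.

Lemma col_neq0 V k : V \in unitmx -> col k V != 0.
Proof.
move=> uV; rewrite colE; apply/eqP => Vk.
have /matrixP/(_ k 0) : (delta_mx k 0 : 'cV[R]_n) = 0.
  by rewrite -(mulKmx uV (delta_mx k 0)) Vk mulmx0.
by rewrite !mxE !eqxx => /eqP; rewrite oner_eq0.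
Qed.

Lemma is_labelE V : is_label V <-> V \in unitmx.
Proof.
rewrite /is_label (_ : label_seq V = [tuple col k V | k < n]) //.
split=> [bV|uV]; last first.
  rewrite basisEdim size_tuple dimvf dim_matrix /= mulr1 leqnn andbT.
  apply/subvP => x _; rewrite -(mulKVmx uV x) mulmx_sum_col.
  apply: memv_suml => k _; apply: memvZ; apply: memv_span.
  by apply/mapP; exists k; rewrite ?mem_enum.
have ex x : exists s, V *m s = x.
  have := coord_basis bV (memvf x); set c := coord _ => xE.
  exists (\col_k c k x); rewrite mulmx_sum_col [RHS]xE.
  by apply: eq_bigr => k _; rewrite mxE -tnth_nth tnth_mktuple.
(* A chosen preimage of each standard basis vector gives a column of a right inverse, which suffices
   for a square matrix. *)
pose B := \matrix_(i, j) (xget 0 [set s : 'cV_n | V *m s = delta_mx j 0]) i 0.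
suff VB : V *m B = 1%:M by case/mulmx1_unit: VB.
apply/matrixP => i j.
have /= /matrixP/(_ i 0) := xgetPex 0 (ex (delta_mx j 0)).
rewrite !mxE eqxx andbT => <-.
by apply: eq_bigr => k _; rewrite mxE.
Qed.

Lemma convex_setE C : convex_set (C : set (convex_lmodType 'cV[R]_n)) <->
  forall x y t, 0 <= t <= 1 -> C x -> C y -> C (t *: x + (1 - t) *: y).
Proof.
split=> [cC x y t /andP[t0 t1] Cx Cy|cC x y t /set_mem Cx /set_mem Cy].
  by have := cC x y (Itv01 t0 t1); rewrite !inE; apply.
by apply/mem_set; apply: cC => //; apply/andP; split; [exact: ge0|exact: le1].
Qed.

End Labels.

(** * Parallelotopes *)

Section Parallelotopes.
Context {R : realType} {n : nat}.
Implicit Types (x a s : 'cV[R]_n) (V : 'M[R]_n) (C P F S : set 'cV[R]_n).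
Implicit Types (k : 'I_n) (e : {ffun 'I_n -> bool}) (b c : R).

Definition cube : set 'cV[R]_n := [set s | forall k, `|s k 0| <= 1].

Definition sign_vector e : 'cV[R]_n := \col_k (-1) ^+ e k.

(** Written as a sum, so that applying [V] becomes a shift along [col k V]. *)
Definition set_coord s k c : 'cV[R]_n := s + (c - s k 0) *: delta_mx k 0.

Lemma set_coordE s k c i : set_coord s k c i 0 = if i == k then c else s i 0.
Proof.
rewrite !mxE eqxx andbT; case: eqP => [->|_]; last by rewrite mulr0 addr0.
by rewrite mulr1 addrC subrK.
Qed.

Lemma mulmx_set_coord V s k c :
  V *m set_coord s k c = V *m s + (c - s k 0) *: col k V.
Proof. by rewrite mulmxDr -scalemxAr -colE. Qed.

Lemma cube_set_coord s k c : cube s -> `|c| <= 1 -> cube (set_coord s k c).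
Proof. by move=> cs c1 i; rewrite set_coordE; case: ifP. Qed.

Lemma cube0 : cube 0.
Proof. by move=> k; rewrite mxE normr0. Qed.

Lemma cube_sign_vector e : cube (sign_vector e).
Proof. by move=> k; rewrite mxE normr_sign. Qed.

Lemma cube_delta k : cube (delta_mx k 0).
Proof.
by move=> i; rewrite mxE eqxx andbT; case: eqP => _; rewrite ?normr1 ?normr0.
Qed.

Lemma sign_sumE V e : sign_sum V e = V *m sign_vector e.
Proof. by rewrite mulmx_sum_col; apply: eq_bigr => k _; rewrite mxE. Qed.

Lemma sign_vectorP s :
  (forall k, s k 0 = 1 \/ s k 0 = -1) -> exists e, s = sign_vector e.
Proof.
move=> s1; exists [ffun k => s k 0 == -1]; apply/matrixP => k j.
rewrite ord1 mxE ffunE; case: (s1 k) => ->; last by rewrite eqxx.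
by rewrite (_ : (1 == -1 :> R) = false) //; apply/negbTE/eqP; lra.
Qed.

(** Induction on a list [l] outside which all coordinates are already 1 or -1: a point lies on the
    segment between the two points obtained by pushing one coordinate of [l] to 1 and to -1. *)
Lemma cube_sub_convex V C : convex_set (C : set (convex_lmodType 'cV[R]_n)) ->
  range (sign_sum V) `<=` C -> forall s, cube s -> C (V *m s).
Proof.
move=> /convex_setE cC VC; suff CV (l : seq 'I_n) : forall s, cube s ->
    (forall k, k \notin l -> s k 0 = 1 \/ s k 0 = -1) -> C (V *m s).
  by move=> s cs; apply: (CV (enum 'I_n)) => // k; rewrite mem_enum.
elim: l => [|k l IH] s cs sl.
  have [e ->] : exists e, s = sign_vector e by apply: sign_vectorP => k; exact: sl.
  by apply: VC; exists e => //; rewrite sign_sumE.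
have Ck c : c = 1 \/ c = -1 -> C (V *m set_coord s k c).
  move=> c1; apply: IH => [|i il].
    by apply: cube_set_coord => //; case: c1 => ->; rewrite ?normrN normr1.
  by rewrite set_coordE; case: eqP => // /eqP ik; apply: sl; rewrite inE negb_or ik.
have /andP[s1 s2] : -1 <= s k 0 <= 1 by rewrite -ler_norml; exact: cs.
have -> : V *m s = ((1 + s k 0) / 2) *: (V *m set_coord s k 1)
    + (1 - (1 + s k 0) / 2) *: (V *m set_coord s k (-1)).
  by rewrite !mulmx_set_coord; apply/matrixP => i j; rewrite !mxE; field.
by apply: cC; [lra|apply: Ck; left|apply: Ck; right].
Qed.

Lemma parallelotopeE V x : parallelotope V x <-> exists2 s, cube s & x = V *m s.
Proof.
split=> [|[s cs ->]]; last first.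
  by move=> C [cC VC]; exact: (cube_sub_convex cC VC).
move=> /(_ [set V *m s | s in cube]) h.
have [|s cs <-] := h; last by exists s.
split=> [|_ [e _ <-]]; last first.
  by exists (sign_vector e); [exact: cube_sign_vector|rewrite sign_sumE].
apply/convex_setE => _ _ t /andP[t0 t1] [s cs <-] [s' cs' <-].
exists (t *: s + (1 - t) *: s'); last by rewrite mulmxDr !scalemxAr.
move=> k; rewrite !mxE.
move: (cs k) (cs' k); rewrite !ler_norml => /andP[? ?] /andP[? ?].
by apply/andP; split; nra.
Qed.

(** The functional adding up the coordinates in the basis [V], each with the sign given by [e], has
    maximum n on the parallelotope. By [gap], n minus its value is a sum of nonnegative terms, all
    zero only at the vertex. *)
Lemma sign_sum_is_vertex V e :
  V \in unitmx -> is_vertex (parallelotope V) (sign_sum V e).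
Proof.
move=> uV; pose a := (invmx V)^T *m sign_vector e; exists a, n%:R.
have aV s : dot a (V *m s) = \sum_k (-1) ^+ e k * s k 0.
  by rewrite -dot_mulmx mulKmx // dotE; apply: eq_bigr => k _; rewrite mxE.
have sk s k : cube s -> 0 <= 1 - (-1) ^+ e k * s k 0.
  move=> /(_ k); rewrite ler_norml => /andP[? ?].
  by case: (e k); rewrite ?expr0 ?expr1; lra.
have gap s : n%:R - dot a (V *m s) = \sum_k (1 - (-1) ^+ e k * s k 0).
  by rewrite aV sumrB sumr_const card_ord.
split=> [x /parallelotopeE[s cs ->]|].
  by rewrite -subr_ge0 gap sumr_ge0 // => k _; exact: sk.
rewrite eqEsubset; split=> [_ ->|x []].
  split.
    apply/parallelotopeE; exists (sign_vector e); last exact: sign_sumE.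
    exact: cube_sign_vector.
  rewrite /hyperplane /= sign_sumE; apply/eqP; rewrite -subr_eq0 -oppr_eq0 opprB gap.
  by rewrite big1 // => k _; rewrite mxE -expr2 sqrr_sign subrr.
move=> /parallelotopeE[s cs ->]; rewrite /hyperplane /= => aVs.
have := gap s; rewrite aVs subrr => /esym/eqP; rewrite psumr_eq0; last first.
  by move=> k _; exact: sk.
move=> /allP s0; rewrite sign_sumE; congr (_ *m _); apply/matrixP => k j.
rewrite ord1 mxE; have := s0 k (mem_index_enum k).
by rewrite /= subr_eq0 => /eqP; case: (e k); rewrite ?expr0 ?expr1; lra.
Qed.

(** If a coordinate were strictly between -1 and 1, moving it both ways would stay in the
    parallelotope; the valid inequality then makes [a] orthogonal to [col k V], and the face
    contains a second point. *)
Lemma vertex_is_sign_sum V x : V \in unitmx -> is_vertex (parallelotope V) x ->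
  exists e, x = sign_sum V e.
Proof.
move=> uV [a [b [ab xE]]].
have [/parallelotopeE[s cs xs] ax] : (parallelotope V `&` hyperplane a b) x.
  by rewrite -xE.
suff s1 k : s k 0 = 1 \/ s k 0 = -1.
  by have [e es] := sign_vectorP s1; exists e; rewrite sign_sumE -es.
apply: contrapT => /not_orP[/eqP s1 /eqP s2].
have : `|s k 0| < 1.
  rewrite lt_neqAle cs andbT; apply/negP; rewrite eqr_norml ler01 andbT.
  by rewrite (negbTE s1) (negbTE s2).
rewrite ltr_norml => /andP[l1 l2].
have upd c : `|c| <= 1 -> parallelotope V (x + (c - s k 0) *: col k V).
  move=> c1; apply/parallelotopeE; exists (set_coord s k c).
    exact: cube_set_coord.
  by rewrite mulmx_set_coord xs.
have u1 : `|1 : R| <= 1 by rewrite normr1.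
have um1 : `|- 1 : R| <= 1 by rewrite normrN normr1.
have {}ax : dot a x = b by [].
have := ab _ (upd _ u1); have := ab _ (upd _ um1); rewrite !dot_simp ax => h1 h2.
have ak : dot a (col k V) = 0 by nra.
have : (parallelotope V `&` hyperplane a b) (x + (1 - s k 0) *: col k V).
  by split; [exact: upd|rewrite /hyperplane /= !dot_simp ax ak mulr0 addr0].
rewrite -xE /= => /eqP; rewrite addrC -subr_eq0 addrK scaler_eq0.
by rewrite (negbTE (col_neq0 k uV)) orbF => /eqP; lra.
Qed.

Lemma inscribedE S V : V \in unitmx ->
  inscribed S (parallelotope V) <-> forall e, S (sign_sum V e).
Proof.
move=> uV; split=> [iS e|Se x]; first by apply: iS; exact: sign_sum_is_vertex.
by move=> /(vertex_is_sign_sum uV)[e ->].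
Qed.

End Parallelotopes.

(** * Orthogonal columns: vertices on the sphere, and facets *)

Section OrthogonalLabels.
Context {R : realType} {n : nat}.
Implicit Types (x y a s : 'cV[R]_n) (V : 'M[R]_n) (C P F S : set 'cV[R]_n).
Implicit Types (k : 'I_n) (e : {ffun 'I_n -> bool}) (b c : R).

Definition orthogonal_cols V : Prop :=
  forall i j, i != j -> dot (col i V) (col j V) = 0.

Lemma dot_col_mulmx V s k : orthogonal_cols V ->
  dot (col k V) (V *m s) = s k 0 * dot (col k V) (col k V).
Proof.
move=> oV; rewrite mulmx_sum_col dot_sumr (bigD1 k) //= dotZr big1 ?addr0 //.
by move=> i ik; rewrite dotZr oV ?mulr0 // eq_sym.
Qed.

Lemma dot_mulmx_mulmx V s : orthogonal_cols V ->
  dot (V *m s) (V *m s) = \sum_k s k 0 ^+ 2 * dot (col k V) (col k V).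
Proof.
move=> oV; rewrite [X in dot _ X]mulmx_sum_col dot_sumr; apply: eq_bigr => k _.
by rewrite dotZr dotC dot_col_mulmx // mulrA expr2.
Qed.

Lemma orthogonal_cols_unitmx V :
  orthogonal_cols V -> (forall k, col k V != 0) -> V \in unitmx.
Proof.
(* The transpose with rows divided by the squared lengths is a left inverse. *)
move=> oV V0; pose B := \matrix_(i, j) (V j i / dot (col i V) (col i V)).
suff BV : B *m V = 1%:M by case/mulmx1_unit: BV.
apply/matrixP => i j; rewrite !mxE.
transitivity (dot (col i V) (col j V) / dot (col i V) (col i V)).
  by rewrite dotE mulr_suml; apply: eq_bigr => k _; rewrite !mxE mulrAC.
by have [<-|ij] := eqVneq i j; rewrite ?divff ?dot_eq0 // oV // mul0r.
Qed.

(** For orthogonality, start from the vertex with all signs +1 and flip sign i, sign j, or both: the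
    alternating sum of the four squared lengths is 8 <v_i, v_j>, and it is 1 - 1 - 1 + 1 = 0. *)
Lemma sign_sum_unit_sphere V : (forall e, unit_sphere (sign_sum V e)) <->
  orthogonal_cols V /\ \sum_k dot (col k V) (col k V) = 1.
Proof.
split=> [h|[oV V1] e]; last first.
  apply/enorm_eq1; rewrite sign_sumE dot_mulmx_mulmx // -V1.
  by apply: eq_bigr => k _; rewrite mxE sqrr_sign mul1r.
have h1 s : (forall k, s k 0 = 1 \/ s k 0 = -1) -> dot (V *m s) (V *m s) = 1.
  by move=> /sign_vectorP[e ->]; rewrite -sign_sumE; apply/enorm_eq1; exact: h.
pose s0 : 'cV[R]_n := const_mx 1.
have s0E k : s0 k 0 = 1 by rewrite mxE.
have oV : orthogonal_cols V.
  move=> i j ij.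
  have E0 := h1 s0 (fun k => or_introl (s0E k)).
  have flip s k : (forall k, s k 0 = 1 \/ s k 0 = -1) ->
      forall k', set_coord s k (-1) k' 0 = 1 \/ set_coord s k (-1) k' 0 = -1.
    by move=> s1 k'; rewrite set_coordE; case: eqP => // _; right.
  have s01 k : s0 k 0 = 1 \/ s0 k 0 = -1 by left.
  have := h1 _ (flip _ j (flip _ i s01)).
  have := h1 _ (flip _ j s01); have := h1 _ (flip _ i s01).
  rewrite !mulmx_set_coord !set_coordE (eq_sym j i) (negbTE ij) !s0E.
  move: E0; move: (V *m s0) => x.
  rewrite !dot_simp (dotC (col i V) x) (dotC (col j V) x) (dotC (col j V) (col i V)).
  by move=> E0 Ei Ej Eij; lra.
split=> //; rewrite -(h1 s0) => [|k]; last by left.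
by rewrite dot_mulmx_mulmx //; apply: eq_bigr => k _; rewrite s0E expr1n mul1r.
Qed.

Lemma affine_hull_facet V k (H := hyperplane (col k V) (dot (col k V) (col k V))) :
  V \in unitmx -> orthogonal_cols V ->
  affine_hull (parallelotope V `&` H) = H.
Proof.
move=> uV oV; rewrite eqEsubset; split.
  by apply: smallest_sub; [exact: affine_hyperplane|exact: subIsetr].
have vk0 : dot (col k V) (col k V) != 0 by rewrite dot_eq0 col_neq0.
move=> x Hx C [aC FC]; rewrite -(mulKVmx uV x) in Hx *.
move: (invmx V *m x) Hx => s; rewrite /H /hyperplane /= dot_col_mulmx // => sk.
have {}sk : s k 0 = 1 by apply: (mulIf vk0); rewrite mul1r.
(* [M] is nonzero and bounds every coordinate, so contracting [s] by the factor [M] towards the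
   facet centre [d] lands in the cube. The point is then on the line through the centre and this
   point [s'] of the facet. *)
pose M := 1 + \sum_i `|s i 0|.
have sM i : `|s i 0| <= M.
  rewrite /M (bigD1 i) //= addrCA lerDl addr_ge0 // sumr_ge0 //.
have M1 : 1 <= M by rewrite lerDl sumr_ge0.
have M0 : M != 0 by rewrite gt_eqF // (lt_le_trans ltr01).
pose d := delta_mx k 0 : 'cV[R]_n.
have dk : d k 0 = 1 by rewrite mxE !eqxx.
pose s' := d + M^-1 *: (s - d).
have -> : V *m s = (1 - M) *: (V *m d) + M *: (V *m s').
  rewrite !scalemxAr -mulmxDr; congr (_ *m _).
  by rewrite scalerDr scalerA divff // scale1r addrA -scalerDl subrK scale1r addrC subrK.
have s'k : s' k 0 = 1 by rewrite !mxE !eqxx sk subrr mulr0 addr0.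
apply: aC; apply: FC; split; rewrite /H /hyperplane /= ?dot_col_mulmx ?dk ?s'k ?mul1r //.
  by apply/parallelotopeE; exists d => //; exact: cube_delta.
apply/parallelotopeE; exists s' => // i.
have [->|ik] := eqVneq i k; first by rewrite s'k normr1.
rewrite !mxE (negbTE ik) /= add0r subr0 normrM normfV (ger0_norm (le_trans ler01 M1)).
by rewrite mulrC ler_pdivrMr ?mul1r ?sM // (lt_le_trans ltr01).
Qed.

Lemma facet_parallelotope V k : V \in unitmx -> orthogonal_cols V ->
  is_facet (parallelotope V)
    (parallelotope V `&` hyperplane (col k V) (dot (col k V) (col k V))).
Proof.
move=> uV oV; split; last first.
  exists (col k V), (dot (col k V) (col k V)).
  by split; [exact: col_neq0|exact: affine_hull_facet].
exists (col k V), (dot (col k V) (col k V)); split=> // x /parallelotopeE[s cs ->].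
rewrite dot_col_mulmx // ler_piMl ?dot_ge0 //.
by have := cs k; rewrite ler_norml => /andP[].
Qed.

(** Some column is not orthogonal to [a], and on [F] its coordinate must sit at the end [c] favoured
    by [a], or the inequality could be violated. So [F] lies in [H], and since its affine hull is a
    hyperplane, that hull is [H]. Conversely the hull of [F] stays in [hyperplane a b], so [F] is
    all of the parallelotope within [H]. *)
Lemma facet_parallelotopeE V F : V \in unitmx -> orthogonal_cols V ->
  is_facet (parallelotope V) F -> exists k c,
    let H := hyperplane (col k V) (c * dot (col k V) (col k V)) in
    [/\ c ^+ 2 = 1, F = parallelotope V `&` H & affine_hull F = H].
Proof.
move=> uV oV [[a [b [ab FE]]] [a' [b' [a'0 hF]]]].
have a'a' : dot a' a' != 0 by rewrite dot_eq0.
have sub : F `<=` affine_hull F by exact: sub_gen_smallest.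
have [x Fx] : exists x, F x.
  apply: contrapT => /forallNP F0.
  have F00 : F = set0 by rewrite -subset0 => x /F0.
  have : hyperplane a' b' ((b' / dot a' a') *: a').
    by rewrite /hyperplane /= dotZr divfK.
  by rewrite -hF F00 affine_hull0.
have FP y : F y -> parallelotope V y by rewrite FE => -[].
have Fb y : F y -> dot a y = b by rewrite FE => -[].
(* Otherwise [F] is the improper face, the whole parallelotope; its hull contains 0 and a basis,
   which forces the normal [a'] to vanish. *)
have [k ak] : exists k, dot a (col k V) != 0.
  apply: contrapT => /forallNP a0.
  have aP s : dot a (V *m s) = 0.
    rewrite mulmx_sum_col dot_sumr big1 // => k _; rewrite dotZr.
    by have /negP/negPn/eqP -> := a0 k; rewrite mulr0.
  have b0 : b = 0 by rewrite -(Fb x) //; have /parallelotopeE[s _ ->] := FP x Fx.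
  have PF y : parallelotope V y -> dot a' y = b'.
    move=> Py; suff : affine_hull F y by rewrite hF.
    apply: sub; rewrite FE; split=> //; rewrite /hyperplane /= b0.
    by have /parallelotopeE[s _ ->] := Py.
  have b'0 : b' = 0.
    rewrite -(PF 0) ?dot0r //; apply/parallelotopeE.
    by exists 0; [exact: cube0|rewrite mulmx0].
  move/eqP: a'0; apply; apply/eqP; rewrite -dot_eq0; apply/eqP.
  rewrite -{2}(mulKVmx uV a') mulmx_sum_col dot_sumr big1 // => k _.
  rewrite dotZr PF ?b'0 ?mulr0 //; apply/parallelotopeE.
  by exists (delta_mx k 0); [exact: cube_delta|rewrite -colE].
pose c := Num.sg (dot a (col k V)).
have c2 : c ^+ 2 = 1 by rewrite sqr_sg ak.
have c1 : `|c| <= 1 by rewrite normr_sg ak.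
exists k, c => H.
have FH : F `<=` H.
  move=> y Fy; have /parallelotopeE[s cs yE] := FP y Fy.
  rewrite /H /hyperplane /= yE dot_col_mulmx //; congr (_ * _).
  have : dot a (V *m set_coord s k c) <= b.
    by apply: ab; apply/parallelotopeE; exists (set_coord s k c) => //; exact: cube_set_coord.
  rewrite mulmx_set_coord -yE dotDr (Fb y Fy) gerDl dotZr mulrBl subr_le0.
  have := cs k; rewrite ler_norml /c => /andP[s1 s2].
  case: (sgrP (dot a (col k V))) ak => [_ //|p _|p _].
    by rewrite ler_pM2r // => s3; apply/le_anti/andP.
  by rewrite ler_nM2r // => s3; apply/le_anti/andP.
have HE : affine_hull F = H.
  rewrite hF; apply: hyperplane_sub_eq a'0 (col_neq0 k uV) _.
  by rewrite -hF; apply: smallest_sub => //; exact: affine_hyperplane.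
split=> //; rewrite eqEsubset; split=> y; first by move=> Fy; split; [exact: FP|exact: FH].
move=> [Py]; rewrite -HE FE => hy; split=> //; move: y hy {Py}.
by apply: smallest_sub; [exact: affine_hyperplane|exact: subIsetr].
Qed.

End OrthogonalLabels.

(** * Ellipsoids and tight parallelotopes *)

Section Curves.
Context {R : realType}.

(** Bundles the coordinate as a linear map, the form expected by the results on differentials of
    continuous linear maps. *)
Lemma coord_linear (m n : nat) (i : 'I_m) (j : 'I_n) :
  exists2 L : {linear 'M[R]_(m, n) -> R}, continuous L & L = (fun M => M i j) :> (_ -> _).
Proof.
have lin : linear (fun M : 'M[R]_(m, n) => M i j : R) by move=> a M N; rewrite !mxE.
pose mix := GRing.isLinear.Build _ _ _ _ _ lin.
pose L : {linear 'M[R]_(m, n) -> R} := HB.pack (fun M : 'M[R]_(m, n) => M i j) mix.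
by exists L => //; exact: coord_continuous.
Qed.

Lemma is_derive1_coord m n (f : R -> 'M[R]_(m, n)) (t : R) df i j :
  is_derive t 1 f df -> is_derive t 1 (fun s => f s i j) (df i j).
Proof.
move=> [fd <-]; have dft : differentiable f t by apply/derivable1_diffP.
have [L cL LE] := @coord_linear m n i j.
have dL : differentiable L (f t) by exact: linear_differentiable.
have dLf : differentiable (L \o f) t by exact: differentiable_comp.
rewrite (_ : (fun s => _) = L \o f); last by rewrite LE.
split; first exact: diff_derivable.
by rewrite (deriveE (1 : R) dLf) diff_comp // (diff_lin _ cL) (deriveE (1 : R) dft) /= LE.
Qed.

Lemma is_derive1_Zl (V : normedModType R) (f : R -> R) (w : V) (t df : R) :
  is_derive t 1 f df -> is_derive t 1 (fun s => f s *: w) (df *: w).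
Proof.
move=> [fd <-]; have dft : differentiable f t by apply/derivable1_diffP.
have dfw := differentiableZl w dft.
split; first exact: diff_derivable.
by rewrite (deriveE (1 : R) dfw) diffZl // (deriveE (1 : R) dft).
Qed.

End Curves.

(** * Tangent space of the ellipsoid *)

Section Ellipsoids.
Context {R : realType} {n : nat}.
Implicit Types (x y u w : 'cV[R]_n) (A V : 'M[R]_n).

Lemma posdefmx_unitmx A : A^T = A -> posdefmx A -> A \in unitmx.
Proof.
move=> At Apos; rewrite -row_free_unit; apply: inj_row_free => v vA.
apply: trmx_inj; rewrite trmx0; apply/eqP; apply/negPn/negP => /Apos.
by rewrite -{1}At -trmx_mul vA trmx0 dot0r ltxx.
Qed.

Lemma is_derive1_dot (c : R -> 'cV[R]_n) (B : 'M[R]_n) (t : R) w :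
  is_derive t 1 c w ->
  is_derive t 1 (fun s => dot (B *m c s) (B *m c s))
    (2 * dot (B *m c t) (B *m w)).
Proof.
move=> cw; pose g i s := (B *m c s) i 0.
have gE i : g i = \sum_j B i j *: (fun s => c s j 0).
  by apply/funext => s; rewrite /g mxE fct_sumE.
have dg i : is_derive t 1 (g i) ((B *m w) i 0).
  rewrite gE mxE; apply: is_derive_sum => j.
  by apply: is_deriveZ; exact: is_derive1_coord.
rewrite (_ : (fun s => _) = \sum_i g i ^+ 2); last first.
  by apply/funext => s; rewrite dotE fct_sumE.
rewrite dotE mulr_sumr; apply: is_derive_sum => i.
have := is_deriveX 2 (dg i); rewrite /= expr1 /GRing.scale /= mulrA; exact.
Qed.

(** Pulled back by the inverse of [A], a curve on the ellipsoid has constant length 1, so its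
    velocity is orthogonal to [u]. Conversely the velocity is realized by the image under [A] of a
    great circle. *)
Lemma tangent_space_ellipsoid A u w : A \in unitmx -> dot u u = 1 ->
  tangent_space (ellipsoid A) (A *m u) w <-> dot u (invmx A *m w) = 0.
Proof.
move=> uA u1; split=> [[c [c0 cE cw]]|].
  have := is_derive1_dot (invmx A) cw; rewrite c0 mulKmx // => -[_].
  rewrite (@near_eq_derive R R R _ (cst 1)) ?derive_cst.
    by move=> /esym/eqP; rewrite mulf_eq0 pnatr_eq0 => /eqP.
  apply: filterS cE => t [y /enorm_eq1 y1 <-].
  by rewrite mulKmx.
set z := invmx A *m w => uz.
have wE : w = A *m z by rewrite mulKVmx.
have [z0|z0] := eqVneq z 0.
  exists (fun=> A *m u); split=> //; last by rewrite wE z0 mulmx0; exact: is_derive_cst.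
  by near=> t; exists u => //; apply/enorm_eq1.
pose r := enorm z; have r0 : r != 0 by rewrite gt_eqF // enorm_gt0.
(* Great circle through [u] with angular speed [r], so that its initial velocity is [z] and not
   merely its direction. *)
exists (fun t => cos (r * t) *: (A *m u) + (sin (r * t) / r) *: w); split.
- by rewrite mulr0 cos0 sin0 mul0r scale0r addr0 scale1r.
- near=> t; exists (cos (r * t) *: u + (sin (r * t) / r) *: z).
    apply/enorm_eq1; rewrite !dot_simp u1 (dotC z u) uz !mulr0 addr0 add0r mulr1.
    by rewrite -sqr_enorm -/r -[RHS](cos2Dsin2 (r * t)); field.
  by rewrite mulmxDr -!scalemxAr -wE.
- have dr : is_derive (0 : R) 1 (fun t => r * t) r.
    by have := is_deriveZ r (is_derive_id (0 : R) 1); rewrite /GRing.scale /= mulr1.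
  have dcos : is_derive (0 : R) 1 (fun t => cos (r * t)) (- sin (r * 0) * r).
    exact: (is_derive1_comp (is_derive_cos (r * 0)) dr).
  have dsin : is_derive (0 : R) 1 (fun t => sin (r * t)) (cos (r * 0) * r).
    exact: (is_derive1_comp (is_derive_sin (r * 0)) dr).
  have dsinr : is_derive (0 : R) 1 (fun t => sin (r * t) / r) 1.
    rewrite (_ : (fun t => _) = r^-1 *: (fun t => sin (r * t))); last first.
      by apply/funext => t; rewrite mulrC.
    by have := is_deriveZ r^-1 dsin; rewrite mulr0 cos0 mul1r [_ *: r](mulVf r0).
  have := is_deriveD (is_derive1_Zl (A *m u) dcos) (is_derive1_Zl w dsinr).
  by rewrite mulr0 sin0 oppr0 mul0r scale0r add0r scale1r.
Unshelve. all: by end_near. Qed.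

End Ellipsoids.

(** * Tightness as equations on the columns *)

Section Tight.
Context {R : realType} {n : nat} (A : 'M[R]_n).
Hypotheses (A_sym : A^T = A) (A_posdef : posdefmx A).
Implicit Types (V Q : 'M[R]_n) (k : 'I_n).

Let uA : A \in unitmx := posdefmx_unitmx A_sym A_posdef.

Let dot_invmx x y : dot x (invmx A *m y) = dot (invmx A *m x) y.
Proof. by rewrite dot_mulmx trmx_inv A_sym. Qed.

(* The support function of the ellipsoid in direction [v] is [enorm (A *m v)]:
   the hyperplane [dot v x = dot v v] is tangent to it iff these agree. *)
Definition supported V : Prop := forall k,
  dot (A *m col k V) (A *m col k V) = dot (col k V) (col k V) ^+ 2.

(** Tangency at A u makes the normals v and A^-1 u parallel, so u = t A v. The contact point being
    on the hyperplane gives t |A v|^2 = |v|^2, and |u| = 1 gives t^2 |A v|^2 = 1; eliminate t. *)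
Lemma circumscribed_supported V : V \in unitmx -> orthogonal_cols V ->
  circumscribed (ellipsoid A) (parallelotope V) -> supported V.
Proof.
move=> uV oV cV k; have v0 := col_neq0 k uV.
have [_ [[u /enorm_eq1 u1 <-] [_ xH] HE]] := cV _ (facet_parallelotope k uV oV).
rewrite affine_hull_facet // in HE.
move: xH v0 HE; set v := col k V; rewrite /hyperplane /= => xH v0 HE.
have vv : 0 < dot v v by rewrite dot_gt0.
have [w vw|t ut] := @orthogonal_complement_sub R n v (invmx A *m u) v0.
  have : hyperplane v (dot v v) (A *m u + w) by rewrite /hyperplane /= dotDr xH vw addr0.
  rewrite [hyperplane _ _]HE => -[w' Tw' /addrI ww'].
  by rewrite -dot_invmx; apply/(tangent_space_ellipsoid w uA u1); rewrite -ww'.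
have uE : u = t *: (A *m v) by rewrite scalemxAr -ut mulKVmx.
have AvE : t * dot (A *m v) (A *m v) = dot v v.
  by rewrite -xH uE -scalemxAr dotZr [in RHS]dot_mulmx A_sym.
have := u1; rewrite uE !dot_simp -AvE => tt.
by rewrite exprMn -[LHS]mul1r -tt; ring.
Qed.

(** The k-th cube coordinate of A u is <A v_k, u> / |v_k|^2, at most |A v_k| / |v_k|^2 = 1 in
    absolute value by Cauchy-Schwarz. *)
Lemma supported_ellipsoid_sub V : V \in unitmx -> orthogonal_cols V ->
  supported V -> ellipsoid A `<=` parallelotope V.
Proof.
move=> uV oV sV _ [u /enorm_eq1 u1 <-]; apply/parallelotopeE.
exists (invmx V *m (A *m u)); last by rewrite mulKVmx.
move=> k; have vv : 0 < dot (col k V) (col k V) by rewrite dot_gt0 col_neq0.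
have := Cauchy_Schwarz (A *m col k V) u; rewrite u1 mulr1 sV.
rewrite -[X in dot (X *m _)]A_sym -dot_mulmx -{1}(mulKVmx uV (A *m u)).
rewrite dot_col_mulmx // exprMn ger_pMl ?exprn_gt0 //.
by rewrite -real_normK ?num_real // expr_le1.
Qed.

Lemma supported_circumscribed V : V \in unitmx -> orthogonal_cols V ->
  supported V -> circumscribed (ellipsoid A) (parallelotope V).
Proof.
move=> uV oV sV F /(facet_parallelotopeE uV oV)[k [c [c2 FE HE]]].
have v0 := col_neq0 k uV; have sVk := sV k.
move: FE HE v0 sVk; set v := col k V => FE HE v0 sVk.
have vv : dot v v != 0 by rewrite dot_eq0.
have c0 : c != 0 by rewrite -sqrf_eq0 c2 oner_neq0.
(* The unit vector at which <v, A u> is extremal on the sphere, with the sign of the facet; its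
   length is 1 because |A v| = |v|^2. *)
pose u := (c / dot v v) *: (A *m v).
have u1 : dot u u = 1.
  by rewrite !dot_simp sVk -[RHS]c2; field.
have vu : dot v (A *m u) = c * dot v v.
  by rewrite -scalemxAr dotZr dot_mulmx A_sym sVk; field.
have Eu : ellipsoid A (A *m u) by exists u => //; apply/enorm_eq1.
exists (A *m u); split=> //.
  (* The contact point must lie in the facet itself, not only in its hyperplane; this follows from
     the ellipsoid being inside the parallelotope. *)
  by rewrite FE; split => //; exact: supported_ellipsoid_sub Eu.
have TE w : tangent_space (ellipsoid A) (A *m u) w <-> dot v w = 0.
  rewrite tangent_space_ellipsoid // dotZl dot_invmx mulKmx //.
  split=> [/eqP|->]; last by rewrite mulr0.
  by rewrite !mulf_eq0 invr_eq0 (negbTE c0) (negbTE vv) => /eqP.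
rewrite HE eqEsubset; split=> [y|_ [w /TE vw <-]]; last first.
  by rewrite /hyperplane /= dotDr vu vw addr0.
rewrite /hyperplane /= => vy; exists (y - A *m u); last by rewrite addrC subrK.
by apply/TE; rewrite dotDr dotNr vy vu subrr.
Qed.

Lemma tight_parallelotopesE V :
  tight_parallelotopes (ellipsoid A) unit_sphere V <->
  [/\ V \in unitmx, orthogonal_cols V,
      \sum_k dot (col k V) (col k V) = 1 & supported V].
Proof.
split=> [[/is_labelE uV [_ iV cV]]|[uV oV V1 sV]].
  have [oV V1] := (sign_sum_unit_sphere V).1 ((inscribedE _ uV).1 iV).
  by split=> //; exact: circumscribed_supported.
have iV : forall e, unit_sphere (sign_sum V e) by apply/sign_sum_unit_sphere.
split; first exact/is_labelE; split; last exact: supported_circumscribed.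
- split; first exact: supported_ellipsoid_sub.
  by move=> x Px C [cC SC]; apply: Px; split=> // _ [e _ <-]; exact: SC.
- exact/inscribedE.
Qed.

End Tight.

(** * Smooth maps *)

Section SmoothMaps.
Context {R : realType} {V : normedModType R}.
Implicit Types (W : normedModType R) (U : set V) (k : nat).

Lemma near_eq_differentiable W (f g : V -> W) (x : V) :
  {near x, f =1 g} -> differentiable f x -> differentiable g x.
Proof.
move=> fg df; have gx : g x = f x by rewrite (nbhs_singleton fg).
have fg0 : \forall h \near 0, f (h + x) = g (h + x).
  by rewrite (near_shift x)/=; near do rewrite /= sub0r addrNK.
have gdf : g \o shift x = cst (g x) + 'd f x +o_ 0 id.
  apply/eqaddoP => e e0; have /eqaddoP/(_ _ e0) := diff_locally df.
  apply: filter_app; near=> h.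
  rewrite !fctE /=; suff -> : g (h + x) = f (h + x) by rewrite gx.
  by apply/esym; near: h.
have dg : 'd g x = 'd f x :> (V -> W).
  by apply: diff_unique => //; exact: diff_continuous.
by apply/diff_locallyP; rewrite dg; split => //; exact: diff_continuous.
Unshelve. all: by end_near. Qed.

Lemma open_near_eq W U (f g : V -> W) (x : V) :
  open U -> {in U, f =1 g} -> U x -> {near x, f =1 g}.
Proof.
move=> oU fg Ux; have : \forall y \near x, U y by exact: open_nbhs_nbhs.
by apply: filterS => y Uy; apply: fg; rewrite inE.
Qed.

(** Derivative formulas are available only on [U]; since [U] is open, values there determine
    derivatives there, and the closure properties below can replace a derivative by its formula. *)
Lemma Ck_on_eq W k U (f g : V -> W) :
  open U -> {in U, f =1 g} -> Ck_on k U f -> Ck_on k U g.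
Proof.
move=> oU; elim: k f g => [|k IH] f g fg /= Cf.
  move=> x Ux; have gx := fg x (mem_set Ux).
  apply: cvg_trans (near_eq_cvg _) _; last by rewrite -gx; exact: Cf.
  exact: open_near_eq fg Ux.
case: Cf => df Df; split=> [x Ux|v].
  by apply: near_eq_differentiable (df x Ux); exact: open_near_eq fg Ux.
apply: (IH ('D_v f)) => [x|]; last exact: Df; rewrite inE => Ux.
by apply: near_eq_derive; exact: open_near_eq fg Ux.
Qed.

Lemma Ck_onS W k U (f : V -> W) : Ck_on k.+1 U f -> Ck_on k U f.
Proof.
elim: k f => [|k IH] f; first by move=> [df _] x /df/differentiable_continuous.
move=> [df Df]; split=> [x Ux|v]; first exact: df.
by apply: IH; exact: Df.
Qed.

Lemma Ck_on_cst W k U (w : W) : Ck_on k U (fun=> w).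
Proof.
elim: k w => [|k IH] w /=; first by move=> x _; exact: cvg_cst.
split=> [x _|v]; first exact: differentiable_cst.
rewrite (_ : (fun x => 'D_v _ x) = fun=> 0); first exact: IH.
by apply/funext => x; exact: derive_cst.
Qed.

Lemma Ck_onD W k U (f g : V -> W) : open U ->
  Ck_on k U f -> Ck_on k U g -> Ck_on k U (fun x => f x + g x).
Proof.
move=> oU; elim: k f g => [|k IH] f g.
  by move=> Cf Cg x Ux; apply: cvgD; [exact: Cf|exact: Cg].
move=> [df Df] [dg Dg]; split=> [x Ux|v].
  by apply: differentiableD; [exact: df|exact: dg].
apply: Ck_on_eq oU _ (IH _ _ (Df v) (Dg v)) => x; rewrite inE => Ux.
by rewrite -deriveD //; apply: diff_derivable; [exact: df|exact: dg].
Qed.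

Lemma Ck_on_sum W k U (I : Type) (r : seq I) (f : I -> V -> W) : open U ->
  (forall i, Ck_on k U (f i)) -> Ck_on k U (fun x => \sum_(i <- r) f i x).
Proof.
move=> oU Cf; elim: r => [|i r IH].
  by apply: Ck_on_eq oU _ (Ck_on_cst k U 0) => x _; rewrite big_nil.
by apply: Ck_on_eq oU _ (Ck_onD oU (Cf i) IH) => x _; rewrite big_cons.
Qed.

Lemma Ck_onM k U (f g : V -> R) : open U ->
  Ck_on k U f -> Ck_on k U g -> Ck_on k U (fun x => f x * g x).
Proof.
move=> oU; elim: k f g => [|k IH] f g.
  by move=> Cf Cg x Ux; apply: cvgM; [exact: Cf|exact: Cg].
move=> Cf Cg; have [df Df] := Cf; have [dg Dg] := Cg; split=> [x Ux|v].
  by apply: differentiableM; [exact: df|exact: dg].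
(* Each Leibniz term pairs a derivative with an undifferentiated factor, whose regularity is lowered
   by one to match. *)
have C1 := IH _ _ (Ck_onS Cf) (Dg v).
have C2 := IH _ _ (Ck_onS Cg) (Df v).
apply: Ck_on_eq oU _ (Ck_onD oU C1 C2) => x; rewrite inE => Ux.
by rewrite [RHS]deriveM //; apply: diff_derivable; [exact: df|exact: dg].
Qed.

Lemma Ck_onZl W k U (f : V -> R) (w : W) : open U ->
  Ck_on k U f -> Ck_on k U (fun x => f x *: w).
Proof.
move=> oU; elim: k f => [|k IH] f.
  by move=> Cf x Ux; apply: cvgZr_tmp; exact: Cf.
move=> [df Df]; split=> [x Ux|v]; first by apply: differentiableZl; exact: df.
apply: Ck_on_eq oU _ (IH _ (Df v)) => x; rewrite inE => Ux.
have dfx := df x Ux.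
by rewrite !deriveE ?diffZl //; exact: differentiableZl.
Qed.

Lemma Ck_on_linear W k U (f : {linear V -> W}) : continuous f -> Ck_on k U f.
Proof.
move=> cf; case: k => [|k]; first by move=> x _; exact: cf.
split=> [x _|v]; first exact: linear_differentiable.
rewrite (_ : (fun x => 'D_v _ x) = fun=> f v); first exact: Ck_on_cst.
apply/funext => x; rewrite deriveE ?diff_lin //; exact: linear_differentiable.
Qed.

(* [h := f^-1/2] satisfies [h' = - f' h^3 / 2], which bootstraps its
   regularity from that of [f]. *)
Lemma Ck_on_invsqrt k U (f : V -> R) : open U -> (forall x, U x -> 0 < f x) ->
  (forall j, Ck_on j U f) -> Ck_on k U (fun x => (Num.sqrt (f x))^-1).
Proof.
move=> oU f0 Cf; pose h x := (Num.sqrt (f x))^-1; rewrite -/h.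
have ds x : U x -> is_derive (f x) 1 (@Num.sqrt R) (2 * Num.sqrt (f x))^-1.
  by move=> Ux; apply: is_derive1_sqrt; exact: f0.
have df x : U x -> differentiable f x by case: (Cf 1%N) => + _; apply.
have dsf x : U x -> differentiable (@Num.sqrt R \o f) x.
  move=> Ux; apply: differentiable_comp; first exact: df.
  by apply/derivable1_diffP; have [] := ds x Ux.
have sf0 x : U x -> Num.sqrt (f x) != 0.
  by move=> Ux; rewrite gt_eqF // sqrtr_gt0 f0.
have dh x : U x -> differentiable h x.
  by move=> Ux; apply: differentiableV; [exact: dsf|exact: sf0].
elim: k => [|k IH]; first by move=> x /dh/differentiable_continuous.
split=> // v; have C3 := Ck_onM oU IH (Ck_onM oU IH IH).
have Dfv : Ck_on k U (fun x => 'D_v f x) by case: (Cf k.+1) => _; apply.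
have C := Ck_onM oU (@Ck_on_cst R k U (- 2^-1)) (Ck_onM oU Dfv C3).
apply: Ck_on_eq oU _ C => x; rewrite inE => Ux.
rewrite (deriveE _ (dh x Ux)) /h diffV; [|exact: dsf|exact: sf0].
rewrite /= diff_comp /=; [|exact: df|by apply/derivable1_diffP; have [] := ds x Ux].
rewrite -(deriveE v (df x Ux)).
rewrite diff1E; last by apply/derivable1_diffP; have [] := ds x Ux.
rewrite /= derive1E (@derive_val _ _ _ _ _ _ _ (ds x Ux)).
have := sf0 x Ux.
rewrite /= /GRing.scale /=; set s := Num.sqrt _ => s0.
set D := 'D_v f x.
by field.
Qed.

End SmoothMaps.

(** * Smooth functions of the columns of a matrix *)

Section SmoothMatrices.
Context {R : realType}.

Lemma Ck_on_coord (m n : nat) (i : 'I_m) (j : 'I_n) k (U : set 'M[R]_(m, n)) :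
  Ck_on k U (fun M : 'M[R]_(m, n) => M i j).
Proof. by have [L cL <-] := @coord_linear R m n i j; exact: (Ck_on_linear _ _ cL). Qed.

Lemma Ck_on_matrix (V : normedModType R) (m n k : nat) (U : set V)
    (f : 'I_m -> 'I_n -> V -> R) : open U ->
  (forall i j, Ck_on k U (f i j)) ->
  Ck_on k U (fun x => \matrix_(i, j) f i j x).
Proof.
move=> oU Cf; have C := Ck_on_sum (index_enum _) oU
  (fun i => Ck_on_sum (index_enum _) oU (fun j => Ck_onZl (delta_mx i j) oU (Cf i j))).
apply: Ck_on_eq oU _ C => x _ /=.
rewrite [RHS]matrix_sum_delta; apply: eq_bigr => i _; apply: eq_bigr => j _.
by rewrite mxE.
Qed.

(** A polynomial in the entries. The factor [B] allows two uses: [1%:M] for normalizing columns, [A]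
    for the inverse map. *)
Lemma Ck_on_dot_mulmx_col (m n : nat) (B : 'M[R]_m) (j : 'I_n) k
    (U : set 'M[R]_(m, n)) : open U ->
  Ck_on k U (fun M => dot (B *m col j M) (B *m col j M)).
Proof.
move=> oU.
have CB i : Ck_on k U (fun M => \sum_l B i l * M l j).
  apply: Ck_on_sum => // l; apply: Ck_onM => //; last exact: Ck_on_coord.
  exact: Ck_on_cst.
apply: Ck_on_eq oU _ (Ck_on_sum (index_enum _) oU (fun i => Ck_onM oU (CB i) (CB i))).
move=> M _; rewrite dotE; apply: eq_bigr => i _; rewrite mxE.
by congr (_ * _); apply: eq_bigr => l _; rewrite mxE.
Qed.

(** Common open domain of both extensions: it contains the invertible matrices, hence all labels and
    all orthogonal frames. *)
Definition nonzero_cols (m n : nat) : set 'M[R]_(m, n) :=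
  [set M | forall j, col j M != 0].

Lemma open_nonzero_cols m n : open (@nonzero_cols m n).
Proof.
rewrite openE => M M0; rewrite /interior.
have H (j : 'I_n) : \forall N \near M, col j N != 0.
  pose f (N : 'M[R]_(m, n)) := dot (1%:M *m col j N) (1%:M *m col j N).
  have fM : 0 < f M by rewrite /f mul1mx dot_gt0.
  have cf : f N @[N --> M] --> f M.
    have /= C := Ck_on_dot_mulmx_col (1%:M : 'M[R]_m) j 0 (@openT 'M[R]_(m, n)).
    exact: C M I.
  apply: filterS (@cvgr_gt R _ (nbhs M) _ f (f M) cf _ fM) => N.
  by rewrite /f mul1mx dot_gt0.
near=> N; move=> j; move: j.
near: N; exact: filter_forall.
Unshelve. all: by end_near. Qed.

Lemma Ck_on_invnorm (m n : nat) (B : 'M[R]_m) (j : 'I_n) k :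
  B \in unitmx -> Ck_on k (@nonzero_cols m n) (fun M => (enorm (B *m col j M))^-1).
Proof.
move=> uB; have oU := @open_nonzero_cols m n.
apply: Ck_on_invsqrt => // [M M0|l]; last exact: Ck_on_dot_mulmx_col.
by rewrite dot_gt0 -enorm_gt0 enorm_mulmx_gt0.
Qed.

Lemma Ck_on_norm (m n : nat) (B : 'M[R]_m) (j : 'I_n) k :
  B \in unitmx -> Ck_on k (@nonzero_cols m n) (fun M => enorm (B *m col j M)).
Proof.
move=> uB; have oU := @open_nonzero_cols m n.
(* The norm is its square times its inverse, so the result on inverse norms suffices. *)
apply: Ck_on_eq oU _ (Ck_onM oU (Ck_on_dot_mulmx_col B j k oU) (Ck_on_invnorm j k uB)).
move=> M; rewrite inE => M0; rewrite -sqr_enorm expr2 mulfK //.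
by rewrite gt_eqF // enorm_mulmx_gt0.
Qed.

End SmoothMatrices.

(** * Gram-Schmidt on orthogonal columns *)

Section GramSchmidt.
Context {R : realType} {n : nat}.
Implicit Types (V Q : 'M[R]_n) (v : 'cV[R]_n).

Definition normalize v : 'cV[R]_n := (enorm v)^-1 *: v.

(** Stated for any accumulator orthogonal to the remaining vectors, so that induction applies; every
    projection subtracted is then zero. *)
Lemma foldl_gram_schmidt_step (l qs : seq 'cV[R]_n) :
  (forall q v, q \in qs -> v \in l -> dot q v = 0) ->
  pairwise (fun v w => dot v w == 0) l ->
  foldl gram_schmidt_step qs l = qs ++ map normalize l.
Proof.
elim: l qs => [|v l IH] qs /= ol; first by rewrite cats0.
move=> /andP[/allP vl ll].
have -> : gram_schmidt_step qs v = rcons qs (normalize v).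
  rewrite /gram_schmidt_step big_seq big1 ?subr0 // => q qqs.
  by rewrite ol ?scale0r ?mem_head.
rewrite IH ?cat_rcons // => q w; rewrite mem_rcons inE => /orP[/eqP ->|qqs] wl.
  by rewrite dotZl (eqP (vl w wl)) mulr0.
by apply: ol => //; rewrite inE wl orbT.
Qed.

Lemma gram_schmidt_orthogonal V : orthogonal_cols V ->
  gram_schmidt V = \matrix_(i, k) ((enorm (col k V))^-1 * V i k).
Proof.
move=> oV; rewrite /gram_schmidt foldl_gram_schmidt_step ?cat0s //; last first.
  rewrite pairwise_map.
  apply: sub_pairwise (_ : pairwise (fun i j : 'I_n => i != j) (enum 'I_n)).
    by move=> i j /= ij; rewrite oV.
  by rewrite -uniq_pairwise enum_uniq.
apply/matrixP => i k; rewrite mxE /label_seq.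
by rewrite -map_comp (nth_map k) ?size_enum_ord // nth_ord_enum !mxE.
Qed.

Lemma orthogonal_groupE Q : orthogonal_group Q <->
  forall i j, dot (col i Q) (col j Q) = (i == j)%:R.
Proof.
have E i j : dot (col i Q) (col j Q) = (Q^T *m Q) i j.
  by rewrite dotE mxE; apply: eq_bigr => k _; rewrite !mxE.
split=> [QQ i j|QQ]; first by rewrite E QQ mxE.
by apply/matrixP => i j; rewrite -E QQ mxE.
Qed.

End GramSchmidt.

(** * The inverse map, the trace condition and smoothness *)

Section InverseGramSchmidt.
Context {R : realType} {n : nat} (A : 'M[R]_n).
Hypotheses (A_sym : A^T = A) (A_posdef : posdefmx A).
Implicit Types (V Q : 'M[R]_n) (k : 'I_n).

Let uA : A \in unitmx := posdefmx_unitmx A_sym A_posdef.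

Definition label_of_frame Q : 'M[R]_n :=
  \matrix_(i, k) (enorm (A *m col k Q) * Q i k).

Lemma col_label_of_frame Q k :
  col k (label_of_frame Q) = enorm (A *m col k Q) *: col k Q.
Proof. by apply/matrixP => i j; rewrite !mxE. Qed.

Lemma col_gram_schmidt V k : orthogonal_cols V ->
  col k (gram_schmidt V) = (enorm (col k V))^-1 *: col k V.
Proof.
by move=> oV; apply/matrixP => i j; rewrite gram_schmidt_orthogonal // !mxE.
Qed.

(** The sum is the trace of Q^T A^2 Q, and the trace is invariant under conjugation. *)
Lemma mxtrace_orthogonal Q : orthogonal_group Q ->
  \sum_k dot (A *m col k Q) (A *m col k Q) = \tr (A *m A).
Proof.
move=> /mulmx1C QQ; transitivity (\tr (Q^T *m (A *m A *m Q))).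
  apply: eq_bigr => k _; rewrite dot_mulmx A_sym mulmxA dotC dotE mxE.
  by apply: eq_bigr => i _; rewrite !colE !mulmxA -!colE !mxE.
by rewrite mxtrace_mulC -(mulmxA (A *m A)) QQ mulmx1.
Qed.

Lemma frame_col_neq0 Q k : orthogonal_group Q -> col k Q != 0.
Proof.
by move=> /orthogonal_groupE QQ; rewrite -dot_eq0 QQ eqxx oner_neq0.
Qed.

Lemma gram_schmidt_orthogonal_group V : V \in unitmx -> orthogonal_cols V ->
  orthogonal_group (gram_schmidt V).
Proof.
move=> uV oV; apply/orthogonal_groupE => i j; rewrite !col_gram_schmidt // !dot_simp.
have [<-|ij] := eqVneq i j; last by rewrite oV // !mulr0.
have v0 := col_neq0 i uV; rewrite -sqr_enorm /=.
by field; rewrite gt_eqF // enorm_gt0.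
Qed.

(** From |A v_k| = |v_k|^2 and q_k = v_k / |v_k| follows |A q_k| = |v_k|, exactly the factor lost in
    normalization. *)
Lemma gram_schmidtK V : V \in unitmx -> orthogonal_cols V -> supported A V ->
  label_of_frame (gram_schmidt V) = V.
Proof.
move=> uV oV sV; apply/matrixP => i k.
have v0 : 0 < enorm (col k V) by rewrite enorm_gt0 col_neq0.
rewrite mxE col_gram_schmidt // -scalemxAr enormZ.
rewrite [enorm (A *m _)]/enorm sV sqrtr_sqr (ger0_norm (dot_ge0 _)) -sqr_enorm.
rewrite gram_schmidt_orthogonal // mxE ger0_norm ?invr_ge0 ?sqrtr_ge0 //.
by field; rewrite gt_eqF.
Qed.

Lemma label_of_frameK Q : orthogonal_group Q ->
  gram_schmidt (label_of_frame Q) = Q.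
Proof.
move=> QQ; have /orthogonal_groupE oQ := QQ.
have oV : orthogonal_cols (label_of_frame Q).
  by move=> i j ij; rewrite !col_label_of_frame !dot_simp oQ (negbTE ij) !mulr0.
apply/matrixP => i k; rewrite gram_schmidt_orthogonal // mxE col_label_of_frame.
have q1 : enorm (col k Q) = 1 by apply/enorm_eq1; rewrite oQ eqxx.
rewrite enormZ q1 mulr1 mxE ger0_norm ?sqrtr_ge0 // mulKf //.
by rewrite gt_eqF // enorm_mulmx_gt0 // frame_col_neq0.
Qed.

Lemma label_of_frame_tight Q : \tr (A *m A) = 1 -> orthogonal_group Q ->
  tight_parallelotopes (ellipsoid A) unit_sphere (label_of_frame Q).
Proof.
move=> trA QQ; have /orthogonal_groupE oQ := QQ.
have oV : orthogonal_cols (label_of_frame Q).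
  by move=> i j ij; rewrite !col_label_of_frame !dot_simp oQ (negbTE ij) !mulr0.
have vv k : dot (col k (label_of_frame Q)) (col k (label_of_frame Q))
    = dot (A *m col k Q) (A *m col k Q).
  by rewrite col_label_of_frame !dot_simp oQ eqxx mulr1 -expr2 sqr_enorm.
apply/(tight_parallelotopesE A_sym A_posdef); split=> //.
- apply: orthogonal_cols_unitmx => // k.
  by rewrite -dot_gt0 vv dot_gt0 -enorm_gt0 enorm_mulmx_gt0 ?frame_col_neq0.
- by rewrite -trA -(mxtrace_orthogonal QQ); apply: eq_bigr => k _; rewrite vv.
- move=> k; rewrite vv col_label_of_frame -scalemxAr !dot_simp mulrA -expr2.
  by rewrite sqr_enorm -expr2.
Qed.

Lemma tight_mxtrace V :
  tight_parallelotopes (ellipsoid A) unit_sphere V -> \tr (A *m A) = 1.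
Proof.
move=> /(tight_parallelotopesE A_sym A_posdef)[uV oV <- sV].
rewrite -(mxtrace_orthogonal (gram_schmidt_orthogonal_group uV oV)).
apply: eq_bigr => k _; rewrite col_gram_schmidt // -scalemxAr !dot_simp sV -sqr_enorm.
by field; rewrite gt_eqF // enorm_gt0 col_neq0.
Qed.

(** The local extension is column normalization, not [gram_schmidt] itself: they need to agree only
    on tight labels, whose columns are orthogonal. *)
Lemma smooth_gram_schmidt :
  smooth_on (tight_parallelotopes (ellipsoid A) unit_sphere) gram_schmidt.
Proof.
have oU := @open_nonzero_cols R n n.
move=> V /(tight_parallelotopesE A_sym A_posdef)[uV _ _ _]; exists (@nonzero_cols R n n).
exists (fun V => \matrix_(i, k) ((enorm (1%:M *m col k V))^-1 * V i k)).
split=> // [k|k|W]; first exact: col_neq0.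
  apply: Ck_on_matrix => // i j; apply: Ck_onM => //; last exact: Ck_on_coord.
  exact: Ck_on_invnorm (unitmx1 _ _).
move=> /set_mem[_ /(tight_parallelotopesE A_sym A_posdef)[_ oW _ _]].
rewrite gram_schmidt_orthogonal //; apply/matrixP => i k.
by rewrite !mxE mul1mx.
Qed.

Lemma smooth_label_of_frame : smooth_on orthogonal_group label_of_frame.
Proof.
have oU := @open_nonzero_cols R n n.
move=> Q QQ; exists (@nonzero_cols R n n), label_of_frame.
split=> // [k|k]; first exact: frame_col_neq0.
apply: Ck_on_matrix => // i j; apply: Ck_onM => //; last exact: Ck_on_coord.
exact: Ck_on_norm.
Qed.

End InverseGramSchmidt.

Unset Implicit Arguments.
Set Strict Implicit.
Set Printing Implicit Defensive.

Theorem theorem2 (R : realType) (n : nat) (n_ge1 : (1 <= n)%N) (A : 'M[R]_n)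
    (A_sym : A^T = A) (A_posdef : posdefmx A)
    (disj : ellipsoid A `&` unit_sphere = set0)
    (incl : ellipsoid A `<=` convex_hull unit_sphere) :
  (tight_parallelotopes (ellipsoid A) unit_sphere !=set0 <->
     \tr (A *m A) = 1) /\
  (\tr (A *m A) = 1 ->
     diffeomorphism (tight_parallelotopes (ellipsoid A) unit_sphere)
       orthogonal_group gram_schmidt).
Proof.
split; first split=> [[V /(tight_mxtrace A_sym A_posdef)] //|trA].
  (* Any frame would do; the standard one is taken. *)
  exists (label_of_frame A 1%:M); apply: label_of_frame_tight => //.
  by rewrite /orthogonal_group /= trmx1 mulmx1.
move=> trA.
have tightE := tight_parallelotopesE A_sym A_posdef.
have gsK : {in tight_parallelotopes (ellipsoid A) unit_sphere,
    cancel gram_schmidt (label_of_frame A)}.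
  by move=> V /set_mem/tightE[uV oV _ sV]; exact: gram_schmidtK.
split; last by exists (label_of_frame A); split=> //; exact: smooth_label_of_frame.
- split=> [V /tightE[uV oV _ _]|V W XV XW VW|Q QQ].
  + exact: gram_schmidt_orthogonal_group.
  + by rewrite -(gsK V XV) VW gsK.
  + exists (label_of_frame A Q); first exact: label_of_frame_tight.
    exact: label_of_frameK.
- exact: smooth_gram_schmidt.
Qed.
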